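(* Let $\mathcal X:=[-2,1]$ and $f(x):=\max\{x,0\}$ on $\mathcal X$, so that $f$ is convex and $1$-Lipschitz, $f_\star:=\min_{\mathcal X}f=0$ and $\mathcal X_\star:=\arg\min_{\mathcal X}f=[-2,0]$. Let $g\colon\mathcal X\to[-1,1]$ be the relative-subgradient selection $g(x):=0$ for $x\le0$ and $g(x):=1$ for $x>0$. Fix constants $0<\underline c\le\overline c<\infty$. Then there exists $n_0=n_0(\underline c,\overline c)\in\mathbb N$ such that for every $n\ge n_0$ and every $c_n\in[\underline c,\overline c]$, setting $\eta:=c_n/\sqrt n$, the following hold. (1) There exists a noise process $(W_k)_{k\in\mathbb N}$ given by a centered additive kernel oracle with $\sigma^2=3$ that is time-homogeneous but not state-independent, such that the iterates $X_{k+1}:=\Pi_{\mathcal X}(X_k-\eta(G_k+W_k))$ with some deterministic initialization $X_1\in\mathcal X_\star$ and $G_k:=g(X_k)$ satisfy $$\mathbb E[f(X_n)-f_\star]\ge\frac1{512}\,\eta\log\frac1\eta\ge\frac{\underline c}{2^{11}}\frac{\log n}{\sqrt n}.$$ (2) There exists a noise process $(W_k)_{k\in\mathbb N}$ given by a centered additive kernel oracle with $\sigma^2=1/2$ that is state-independent but not time-homogeneous, such that the iterates $X_{k+1}:=\Pi_{\mathcal X}(X_k-\eta(G_k+W_k))$ with $X_1\equiv0$ and $G_k:=g(X_k)$ satisfy $$\mathbb E[f(X_n)-f_\star]\ge\frac1{128}\,\eta\log\frac1\eta\ge\frac{\underline c}{2^{11}}\frac{\log n}{\sqrt n}.$$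
   Context: $\Pi_{\mathcal X}(x):=\arg\min_{z\in\mathcal X}|x-z|$ is the projection onto $\mathcal X$. For convex $f$ on $\mathcal X$, a relative subgradient at $x\in\mathcal X$ is a $g\in\mathbb R$ with $f(y)\ge f(x)+g\cdot(y-x)$ for all $y\in\mathcal X$. Set $\mathcal F_1:=\sigma(X_1)$ and $\mathcal F_k:=\sigma(X_1,W_1,\dots,W_{k-1})$. Centered additive kernel oracle with parameter $\sigma>0$: there is a specified family of probability kernels $Q_k\colon\mathcal X\times\mathfrak B(\mathbb R)\to[0,1]$, $k\ge1$ (with $\mathfrak B$ denoting the Borel $\sigma$-field), such that for all $k\ge1$, $x\in\mathcal X$, $A\in\mathfrak B(\mathbb R)$: $\int_{\mathbb R}w\,Q_k(x,dw)=0$, $\int_{\mathbb R}w^2\,Q_k(x,dw)\le\sigma^2$, and $\mathbb P(W_k\in A\mid\mathcal F_k)=Q_k(X_k,A)$ a.s. The kernel family is part of the oracle specification. Time-homogeneous: there is a probability kernel $Q$ with $Q_k(x,\cdot)=Q(x,\cdot)$ for all $k\ge1$ and $x\in\mathcal X$. State-independent: for every $k\ge1$ there is a probability measure $\mu_k$ on $\mathbb R$ with $Q_k(x,\cdot)=\mu_k(\cdot)$ for all $x\in\mathcal X$. *)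

(* Defs.v *)
From mathcomp Require Import all_boot all_order all_algebra.
From mathcomp Require Import all_classical all_reals all_analysis.
From mathcomp Require Import measurable_realfun.
Set Implicit Arguments.
Unset Strict Implicit.
Unset Printing Implicit Defensive.
Import Order.TTheory GRing.Theory Num.Theory.
Import numFieldNormedType.Exports.
Local Open Scope classical_set_scope.
Local Open Scope ring_scope.

Definition argmin (R : realType) (D : set R) (h : R -> R) : set R :=
  [set z | D z /\ forall y, D y -> h z <= h y].

(* The value of h at a minimizer; a junk value when argmin D h is empty. *)
Definition minval (R : realType) (D : set R) (h : R -> R) : R :=
  h (xget 0 (argmin D h)).

Definition projection_onto (R : realType) (D : set R) (x : R) : R :=
  xget 0 (argmin D (fun z => `|x - z|)).

Definition relative_subgradient (R : realType) (D : set R) (f : R -> R)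
    (x g : R) : Prop :=
  forall y, D y -> f x + g * (y - x) <= f y.

(* Probability kernels from D, with its trace Borel sigma-algebra, to R:
   only the values Q x for x in D matter. *)
Definition prob_kernel_on (R : realType) (D : set R)
    (Q : R -> probability R R) : Prop :=
  forall A, measurable A -> measurable_fun D (fun x => Q x A).

(* Processes are indexed from 1, as in X_1, X_2, ... and W_1, W_2, ...;
   the terms of index 0 play no role. *)
Definition history d (T : measurableType d) (R : realType)
    (P : probability T R) (X W : nat -> {RV P >-> R}) (k : nat) : set (set T) :=
  <<s g_sigma_algebra_preimage (X 1%N) `|`
      \bigcup_(j in [set j | (1 <= j < k)%N]) g_sigma_algebra_preimage (W j) >>.

(* Y is a version of the conditional probability P(E | G). *)
Definition cond_prob_version d (T : measurableType d) (R : realType)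
    (P : probability T R) (G : set (set T)) (E : set T) (Y : T -> \bar R)
    : Prop :=
  [/\ forall B, measurable B -> G (Y @^-1` B),
      P.-integrable setT Y &
      forall F, G F -> (\int[P]_(w in F) Y w)%E = P (E `&` F)].

Definition centered_kernel_oracle d (T : measurableType d) (R : realType)
    (P : probability T R) (D : set R) (sigma : R)
    (X W : nat -> {RV P >-> R}) (Q : nat -> R -> probability R R) : Prop :=
  0 < sigma /\
  forall k, (1 <= k)%N ->
  [/\ prob_kernel_on D (Q k),
      forall x, D x -> (\int[Q k x]_w w%:E = 0)%E,
      forall x, D x -> (\int[Q k x]_w (w ^+ 2)%:E <= (sigma ^+ 2)%:E)%E &
      forall A, measurable A ->
        exists2 Y, cond_prob_version P (history X W k) (W k @^-1` A) Y &
                   {ae P, forall w, Y w = Q k (X k w) A}].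

Definition time_homogeneous (R : realType) (D : set R)
    (Q : nat -> R -> probability R R) : Prop :=
  exists2 Q0 : R -> probability R R, prob_kernel_on D Q0 &
    forall k x A, (1 <= k)%N -> D x -> measurable A -> Q k x A = Q0 x A.

Definition state_independent (R : realType) (D : set R)
    (Q : nat -> R -> probability R R) : Prop :=
  forall k, (1 <= k)%N -> exists mu : probability R R,
    forall x A, D x -> measurable A -> Q k x A = mu A.

Definition projected_iterates d (T : measurableType d) (R : realType)
    (P : probability T R) (D : set R) (g : R -> R) (eta : R)
    (X W : nat -> {RV P >-> R}) : Prop :=
  forall k, (1 <= k)%N -> forall w,
    X k.+1 w = projection_onto D (X k w - eta * (g (X k w) + W k w)).

Definition domX (R : realType) : set R := `[-2, 1].
Definition fplus (R : realType) (x : R) : R := Num.max x 0.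
Definition gplus (R : realType) (x : R) : R := if x <= 0 then 0 else 1.
Arguments domX : clear implicits.
Arguments fplus : clear implicits.
Arguments gplus : clear implicits.

(* Main.v *)
Require Import Defs.
From HB Require Import structures.
From mathcomp Require Import all_boot all_order all_algebra.
From mathcomp Require Import all_classical all_reals all_analysis.
From mathcomp Require Import measurable_realfun zify ring lra.
Set Implicit Arguments.
Unset Strict Implicit.
Unset Printing Implicit Defensive.
Import Order.TTheory GRing.Theory Num.Theory.
Import numFieldNormedType.Exports.
Local Open Scope classical_set_scope.
Local Open Scope ring_scope.

(** Why the theorem holds. Without noise a step leaves an iterate in the minimal
    set where it is and lowers a positive one by [eta], so an iterate that
    reaches the height [2 * eta * j] when [j] steps remain ends at height about
    [eta * j]. A centered noise of bounded variance can afford such a jump with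
    a probability of order [1 / j ^ 2], which contributes [eta / j] to the mean
    of the last iterate. Over [m <= j <= m ^ 2], with [m ^ 2] of order
    [1 / eta] so that the jumps stay in the domain, the contributions add up to
    [eta * ln m], of order [eta * ln (1 / eta)]: lemma [Ex_path_last_ge].

    Each jump has to be compensated by a small opposite drift, of order
    [eta / j] in the step with [j] to go. Its total over the at most [m ^ 2]
    steps of the window is of order [eta * m], and the schedule is calibrated
    so that it is at most [eta * m / 4] (lemma [depth_le_quarter]), a fraction
    of what any jump in the window earns. Jumps are rare enough overall that
    the first one comes at a prescribed time with at least [7 / 8] of the
    probability of a jump at that time.

    Both oracles run this schedule. If the noise may depend on time, the
    schedule is followed literally, whatever the state. If it may only depend
    on the state, the compensating drift serves as a clock: an iterate that has
    not jumped sits at time [k] at [- eta * depth k], with [depth] strictly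
    increasing until the window closes, so its position tells the time. Before
    the window a negligible drift, paid by jumps back to the origin, keeps the
    clock running. At all other points the noise is zero; jumps land on
    multiples of [eta], which subgradient steps preserve, so the clock states
    are never met again (lemma [clock_path]).

    The sample space is a finite product of biased coins, a head causing the
    jump at its time and a tail the drift. Conditional
    probabilities given the past are computed by resampling one coin (lemmas
    [Ex_resample] and [noise_cond_prob]), and membership in the history is
    decided by saturation. *)

(** * Finitely supported laws *)

Section fin_law.
Context d (T : measurableType d) (R : realType) (I : finType) (i0 : I).
Variables (w : I -> {nonneg R}) (x : I -> T).

(** Finite sums of measures are indexed by natural numbers, so the index type
    is run through its enumeration; [i0] is only the default value of [nth]. *)
Definition fin_law : set T -> \bar R :=
  msum (fun k => mscale (w (nth i0 (enum I) k)) (dirac (x (nth i0 (enum I) k))))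
       #|I|.

HB.instance Definition _ := Measure.on fin_law.

Lemma sum_nth_enum (U : nmodType) (F : I -> U) :
  \sum_(k < #|I|) F (nth i0 (enum I) k) = \sum_i F i.
Proof.
by rewrite -[RHS]big_enum (big_nth i0) big_mkord -cardE.
Qed.

Lemma fin_lawE A : fin_law A = (\sum_i (w i)%:num * \1_A (x i))%:E.
Proof.
rewrite /fin_law /msum -sum_nth_enum -sumEFin.
by apply: eq_bigr => k _; rewrite /mscale/= EFinM.
Qed.

Lemma fin_law_ge0_integral (f : T -> \bar R) : measurable_fun setT f ->
  (forall t, 0 <= f t)%E ->
  (\int[fin_law]_t f t = \sum_i (w i)%:num%:E * f (x i))%E.
Proof.
move=> mf f0; rewrite ge0_integral_measure_sum//.
rewrite -(sum_nth_enum (fun i => (w i)%:num%:E * f (x i))%E).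
apply: eq_bigr => k _.
by rewrite ge0_integral_mscale// integral_dirac// diracT mul1e.
Qed.

Lemma fin_law_integral (f : T -> R) : measurable_fun setT f ->
  (\int[fin_law]_t (f t)%:E = (\sum_i (w i)%:num * f (x i))%:E)%E.
Proof.
move=> mf; have mf' : measurable_fun setT (EFin \o f) by exact/measurable_EFinP.
rewrite integralE fin_law_ge0_integral//; last exact: measurable_funepos.
rewrite fin_law_ge0_integral//; last exact: measurable_funeneg.
have E (g : T -> \bar R) (h : I -> R) : (forall i, g (x i) = (h i)%:E) ->
    (\sum_i (w i)%:num%:E * g (x i) = (\sum_i (w i)%:num * h i)%:E)%E.
  by move=> gh; rewrite -sumEFin; apply: eq_bigr => i _; rewrite gh EFinM.
rewrite (E _ (fun i => Num.max (f (x i)) 0)); last first.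
  by move=> i; rewrite funeposE/= EFin_max.
rewrite (E _ (fun i => Num.max (- f (x i)) 0)); last first.
  by move=> i; rewrite funenegE/= EFin_max EFinN.
rewrite -EFinB -sumrB; congr EFin; apply: eq_bigr => i _.
rewrite -mulrBr; congr (_ * _).
by case: (leP (f (x i)) 0) => ?; case: (leP (- f (x i)) 0) => ?; lra.
Qed.

Lemma fin_law_integrable (f : T -> R) : measurable_fun setT f ->
  fin_law.-integrable setT (EFin \o f).
Proof.
move=> mf; apply/integrableP; split; first exact/measurable_EFinP.
rewrite (eq_integral (fun t => `|f t|%:E))//.
by rewrite fin_law_integral ?ltry//; exact: measurableT_comp.
Qed.

End fin_law.

Section fin_prob.
Context d (T : measurableType d) (R : realType) (I : finType) (i0 : I).
Variables (w : I -> {nonneg R}) (x : I -> T).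
Hypothesis w1 : \sum_i (w i)%:num = 1.

Definition fin_prob & \sum_i (w i)%:num = 1 := fin_law i0 w x.

HB.instance Definition _ := Measure.on (fin_prob w1).

Let fin_prob_setT : fin_prob w1 setT = 1%E.
Proof.
rewrite /fin_prob fin_lawE; congr EFin; rewrite -[RHS]w1.
by apply: eq_bigr => i _; rewrite indicT mulr1.
Qed.

HB.instance Definition _ := Measure_isProbability.Build _ _ _
  (fin_prob w1) fin_prob_setT.

End fin_prob.

(** * Independent biased coins *)

Definition coins (N : nat) := {ffun 'I_N.+1 -> bool}.
HB.instance Definition _ N := Finite.on (coins N).
HB.instance Definition _ N := isPointed.Build (coins N) [ffun=> false].
HB.instance Definition _ N := @isMeasurable.Build default_measure_display
  (coins N) discrete_measurable discrete_measurable0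
  discrete_measurableC discrete_measurableU.

Lemma coins_measurable_fun N d (T : measurableType d) (D : set (coins N))
  (f : coins N -> T) : measurable_fun D f.
Proof. by []. Qed.

Section coins.
Context (R : realType) (p : nat -> R).
Hypothesis p01 : forall k, 0 <= p k <= 1.

Definition bitp k (b : bool) : R := if b then p k else 1 - p k.

Lemma bitp_ge0 k b : 0 <= bitp k b.
Proof. by have /andP[p0 p1] := p01 k; case: b => //=; rewrite subr_ge0. Qed.

Lemma sum_bitp k : \sum_b bitp k b = 1.
Proof. by rewrite big_bool /= addrC subrK. Qed.

Definition flip_weight N (o : coins N) : R := \prod_(i < N.+1) bitp i (o i).

Lemma flip_weight_ge0 N (o : coins N) : 0 <= flip_weight o.
Proof. by apply: prodr_ge0 => i _; exact: bitp_ge0. Qed.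

Definition Ex N (f : coins N -> R) : R := \sum_o flip_weight o * f o.

Lemma sum_flip_weight N : \sum_(o : coins N) flip_weight o = 1.
Proof.
rewrite -(bigA_distr_bigA (fun i : 'I_N.+1 => bitp i)) /=.
by apply: big1 => i _; exact: sum_bitp.
Qed.

Lemma Ex_le N (f g : coins N -> R) : (forall o, f o <= g o) -> Ex f <= Ex g.
Proof.
by move=> fg; apply: ler_sum => o _; rewrite ler_wpM2l// flip_weight_ge0.
Qed.

Lemma eq_Ex N (f g : coins N -> R) : f =1 g -> Ex f = Ex g.
Proof. by move=> fg; apply: eq_bigr => o _; rewrite fg. Qed.

Lemma Ex_cst N (c : R) : Ex (fun _ : coins N => c) = c.
Proof. by rewrite /Ex -mulr_suml sum_flip_weight mul1r. Qed.

Lemma ExZ N (c : R) (f : coins N -> R) : Ex (fun o => c * f o) = c * Ex f.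
Proof. by rewrite /Ex mulr_sumr; apply: eq_bigr => o _; rewrite mulrCA. Qed.

Lemma Ex_sum N (J : Type) (r : seq J) (P : pred J) (f : J -> coins N -> R) :
  Ex (fun o => \sum_(j <- r | P j) f j o) = \sum_(j <- r | P j) Ex (f j).
Proof.
by rewrite /Ex exchange_big /=; apply: eq_bigr => o _; rewrite mulr_sumr.
Qed.

Lemma ExB N (f g : coins N -> R) : Ex (fun o => f o - g o) = Ex f - Ex g.
Proof. by rewrite /Ex -sumrB; apply: eq_bigr => o _; rewrite mulrBr. Qed.

Definition set_coin N (o : coins N) (k : 'I_N.+1) (b : bool) : coins N :=
  [ffun i => if i == k then b else o i].

(** Independence of the coins, in the form used below: exchanging the old and
    the new value of coin [k] is a weight-preserving involution of the pairs
    (all the coins, a fresh copy of coin [k]). *)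
Lemma Ex_resample N (k : 'I_N.+1) (f : coins N -> R) :
  Ex f = Ex (fun o => \sum_b bitp k b * f (set_coin o k b)).
Proof.
pose F (u : coins N * bool) :=
  flip_weight u.1 * (bitp k u.2 * f (set_coin u.1 k u.2)).
have -> : Ex (fun o => \sum_b bitp k b * f (set_coin o k b)) = \sum_u F u.
  rewrite /Ex (eq_bigr (fun o => \sum_b F (o, b))) => [|o _].
    by rewrite pair_big; apply: eq_bigr; case.
  by rewrite mulr_sumr.
pose h (u : coins N * bool) := (set_coin u.1 k u.2, u.1 k).
have hK : involutive h.
  move=> [v b]; rewrite /h /=; congr pair; last by rewrite ffunE eqxx.
  by apply/ffunP => i; rewrite !ffunE; case: eqP => [->|].
rewrite (reindex_inj (inv_inj hK)) /=.
rewrite (eq_bigr (fun u => flip_weight u.1 * f u.1 * bitp k u.2)); last first.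
  move=> [v b] _; rewrite /F /=.
  rewrite (_ : set_coin (set_coin v k b) k (v k) = v); last first.
    by apply/ffunP => i; rewrite !ffunE; case: eqP => [->|].
  rewrite mulrA [RHS]mulrAC; congr (_ * _).
  rewrite /flip_weight (bigD1 k)//= [in RHS](bigD1 k)//= ffunE eqxx.
  rewrite (eq_bigr (fun i : 'I_N.+1 => bitp i (v i))); first by ring.
  by move=> i /negbTE ik; rewrite ffunE ik.
rewrite /Ex -(pair_bigA _ (fun o b => flip_weight o * f o * bitp k b)) /=.
by apply: eq_bigr => o _; rewrite -mulr_sumr sum_bitp mulr1.
Qed.

Definition flip_weight_nng N (o : coins N) : {nonneg R} :=
  NngNum (flip_weight_ge0 o).

Lemma sum_flip_weight_nng N : \sum_(o : coins N) (flip_weight_nng o)%:num = 1.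
Proof. exact: sum_flip_weight. Qed.

Definition coin_prob N : probability (coins N) R :=
  @fin_prob _ (coins N) R (coins N) [ffun=> false] (@flip_weight_nng N) id
    (sum_flip_weight_nng N).

Lemma coin_probE N A : coin_prob N A = (Ex \1_A)%:E.
Proof. exact: fin_lawE. Qed.

Lemma coin_prob_integral N (f : coins N -> R) :
  (\int[coin_prob N]_o (f o)%:E = (Ex f)%:E)%E.
Proof. exact: fin_law_integral. Qed.

Lemma coin_prob_integrable N (f : coins N -> R) :
  (coin_prob N).-integrable setT (EFin \o f).
Proof. exact: fin_law_integrable. Qed.

Lemma coin_prob_integral_set N (f : coins N -> R) A :
  (\int[coin_prob N]_(o in A) (f o)%:E = (Ex (fun o => \1_A o * f o))%:E)%E.
Proof.
rewrite integral_mkcond -coin_prob_integral; apply: eq_integral => o _.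
rewrite /patch indicE; case: ifPn => _; first by rewrite mul1r.
by rewrite mul0r.
Qed.

Definition first_head N (k : 'I_N.+1) (o : coins N) : bool :=
  o k && [forall i : 'I_N.+1, (i < k)%N ==> ~~ o i].

Lemma Ex_head N (k : 'I_N.+1) : Ex (fun o => (o k)%:R) = p k.
Proof.
rewrite (Ex_resample k) -[RHS](Ex_cst N); apply: eq_Ex => o.
by rewrite big_bool /= !ffunE eqxx /=; ring.
Qed.

Lemma Ex_no_head_ge N (k : 'I_N.+1) :
  1 - \sum_(i < k) p i <=
  Ex (fun o => [forall i : 'I_N.+1, (i < k)%N ==> ~~ o i]%:R).
Proof.
have -> : 1 - \sum_(i < k) p i =
    Ex (fun o : coins N => 1 - \sum_(i < k) (o (inord i))%:R).
  rewrite ExB Ex_cst Ex_sum; congr (_ - _); apply: eq_bigr => i _.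
  by rewrite Ex_head inordK//; exact: ltn_trans (ltn_ord i) (ltn_ord k).
apply: Ex_le => o.
have [_|] := boolP [forall i : 'I_N.+1, (i < k)%N ==> ~~ o i].
  by rewrite gerBl sumr_ge0.
rewrite negb_forall => /existsP[i]; rewrite negb_imply negbK => /andP[ik oi].
rewrite (bigD1 (Ordinal ik))//= inord_val oi.
by rewrite opprD addrA subrr add0r oppr_le0 sumr_ge0.
Qed.

(** Coin [k] is independent of the earlier ones, for which the union bound is
    enough since heads are rare. *)
Lemma Ex_first_head_ge N (k : 'I_N.+1) :
  p k * (1 - \sum_(i < k) p i) <= Ex (fun o => (first_head k o)%:R).
Proof.
have -> : Ex (fun o => (first_head k o)%:R) =
    p k * Ex (fun o : coins N => [forall i : 'I_N.+1, (i < k)%N ==> ~~ o i]%:R).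
  rewrite (Ex_resample k) -ExZ; apply: eq_Ex => o.
  rewrite big_bool /= /first_head !ffunE eqxx /= mulr0 addr0.
  congr (_ * (nat_of_bool _)%:R); apply: eq_forallb => i; rewrite ffunE.
  by case: eqP => [->|//]; rewrite ltnn.
by rewrite ler_wpM2l ?Ex_no_head_ge//; case/andP: (p01 k).
Qed.

End coins.

(** * Histories on a finite sample space *)

(** An event of the history cannot separate two outcomes on which [X 1] and
    the earlier noises agree: the sets with this property form a sigma-algebra
    containing the generators. *)
Lemma history_saturated d (T : measurableType d) (R : realType)
    (P : probability T R) (X W : nat -> {RV P >-> R}) k (F : set T) (o o' : T) :
  history X W k F -> X 1%N o = X 1%N o' ->
  (forall j, (1 <= j < k)%N -> W j o = W j o') -> F o -> F o'.
Proof.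
move=> + X1 Wj; suff sat : history X W k `<=` [set A | A o <-> A o'].
  move=> hF; by have [] : F o <-> F o' := sat _ hF.
apply: smallest_sub.
  split=> [|A AP|A AP]; rewrite /=.
  - by [].
  - by split=> -[_ nA]; split=> // /AP.
  - by split=> -[i _ Ai]; exists i => //; apply/AP.
move=> _ [[B _ <-]|[j jk [B _ <-]]] /=; first by rewrite X1.
by rewrite Wj.
Qed.

(** On a finite space the converse holds: a saturated event is the finite union
    of the level sets of the past that it contains. *)
Lemma saturated_history d (T : measurableType d) (R : realType)
    (P : probability T R) (X W : nat -> {RV P >-> R}) k (F : set T) :
  finite_set [set: T] ->
  (forall o o', (forall j, (1 <= j < k)%N -> W j o = W j o') -> F o -> F o') ->
  history X W k F.
Proof.
move=> finT sat; rewrite /history; set G := (X in <<s X >>).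
pose C o := \bigcap_(j in [set j | (1 <= j < k)%N]) (W j @^-1` [set W j o]).
have FE : F = \bigcup_(o in F) C o.
  apply/seteqP; split=> [t Ft|t' [t Ft Ct]]; first by exists t.
  by apply: (sat t) => // j jk; rewrite (Ct j jk).
rewrite FE; pose U : measurableType _ := g_sigma_algebraType G.
apply: (@fin_bigcup_measurable _ U) => [|t Ft].
  exact: sub_finite_set finT.
apply: (@bigcap_measurableType _ U) => j jk; apply: sub_gen_smallest.
right; exists j => //; exists [set W j t]; first exact: measurable_set1.
by rewrite setTI.
Qed.

(** * The projected method driven by coins *)

Section projection.
Variable R : realType.
Implicit Types x y : R.

Definition clamp x : R := Num.max (- 2) (Num.min x 1).

Lemma clamp_domX x : - 2 <= clamp x <= 1.
Proof. by rewrite /clamp le_max lexx /= ge_max ge_min lexx orbT andbT; lra. Qed.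

Lemma clamp_id x : - 2 <= x <= 1 -> clamp x = x.
Proof.
by move=> /andP[x2 x1]; rewrite /clamp min_l// max_r.
Qed.

Lemma le_clamp x y : y <= x -> y <= 1 -> y <= clamp x.
Proof. by move=> yx y1; rewrite /clamp le_max le_min yx y1 orbT. Qed.

Lemma projection_domXE x : projection_onto (domX R) x = clamp x.
Proof.
have dom y : domX R y <-> - 2 <= y <= 1 by rewrite /domX /= in_itv.
have near y : - 2 <= y <= 1 ->
    `|x - clamp x| <= `|x - y| /\ (`|x - y| <= `|x - clamp x| -> y = clamp x).
  move=> /andP[y2 y1].
  have [x2|x2] := ltP x (- 2).
    rewrite /clamp min_l ?max_l; [|lra|lra].
    by rewrite !ler0_norm; [split; [|move=> ?]; lra|lra|lra].
  have [x1|x1] := leP x 1.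
    rewrite clamp_id ?x2// subrr normr0; split=> [//|].
    by rewrite normr_le0 subr_eq0 => /eqP.
  rewrite /clamp min_r ?max_r; [|lra|lra].
  by rewrite !ger0_norm; [split; [|move=> ?]; lra|lra|lra].
apply: xget_unique => [|y [/dom y2 ymin]].
  split=> [|y /dom y2]; first by apply/dom/clamp_domX.
  exact: (near y y2).1.
by apply: (near y y2).2; apply: ymin; apply/dom/clamp_domX.
Qed.

End projection.

Section process.
Context (R : realType) (N : nat) (p : nat -> R).
Hypothesis p01 : forall k, 0 <= p k <= 1.
Variables (xi : nat -> bool -> R) (kap : nat -> R -> nat) (eta x1 : R).

(** At time [k] in state [x] the noise is [xi j] applied to the [k]-th coin,
    with [j = kap k x]. Letting [j] depend on time or on the state alone gives
    the two kinds of oracles. Time starts at one, whence the repeated [x1]. *)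
Fixpoint path (o : coins N) k : R :=
  if k is k'.+1 then
    if k' == 0%N then x1 else
    clamp (path o k' - eta *
             (gplus R (path o k') + xi (kap k' (path o k')) (o (inord k'))))
  else x1.

Definition noise (o : coins N) k : R := xi (kap k (path o k)) (o (inord k)).

Lemma path1 o : path o 1 = x1. Proof. by []. Qed.

Lemma pathS o k : (0 < k)%N -> path o k.+1 =
  clamp (path o k - eta * (gplus R (path o k) + noise o k)).
Proof. by case: k. Qed.

Lemma eq_path_noise (o o' : coins N) k :
  (forall j, (1 <= j < k)%N -> noise o j = noise o' j) ->
  path o k = path o' k.
Proof.
elim: k => [//|[//|k] IH] eqn.
rewrite [LHS]pathS// [RHS]pathS// IH ?eqn ?leqnn//.
by move=> j /andP[j0 jk]; rewrite eqn// j0 ltnW.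
Qed.

Lemma eq_path_coins (o o' : coins N) k :
  (forall j, (j < k)%N -> o (inord j) = o' (inord j)) -> path o k = path o' k.
Proof.
elim: k => [//|[//|k] IH] eqo.
rewrite [LHS]pathS// [RHS]pathS// /noise IH ?eqo//.
by move=> j jk; rewrite eqo// ltnW.
Qed.

Definition noise_law j : probability R R :=
  @fin_prob _ R R bool false (fun b => NngNum (bitp_ge0 p01 j b)) (xi j)
    (sum_bitp p j).

Lemma noise_lawE j A :
  noise_law j A = (\sum_b bitp p j b * \1_A (xi j b))%:E.
Proof. exact: fin_lawE. Qed.

Lemma noise_law_integral j (f : R -> R) : measurable_fun setT f ->
  (\int[noise_law j]_w (f w)%:E = (\sum_b bitp p j b * f (xi j b))%:E)%E.
Proof. exact: fin_law_integral. Qed.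

Let P := coin_prob p01 N.

Definition path_rv k : {RV P >-> R} :=
  mfun_Sub (mem_set (@coins_measurable_fun N _ R setT (path ^~ k))).

Definition noise_rv k : {RV P >-> R} :=
  mfun_Sub (mem_set (@coins_measurable_fun N _ R setT (noise ^~ k))).

Lemma path_rv_projected_iterates :
  projected_iterates (domX R) (gplus R) eta path_rv noise_rv.
Proof. by move=> k k1 o; rewrite projection_domXE; exact: pathS. Qed.

Hypothesis fresh_coin : forall k o, (0 < k)%N ->
  ((k <= N)%N /\ kap k (path o k) = k) \/
  xi (kap k (path o k)) true = xi (kap k (path o k)) false.

(** The value of the noise law at the current state is a function of the past,
    and events of the past do not involve coin [k]; so resampling coin [k]
    averages the noise over its law without changing either. When the two
    values of the noise coincide no independence is needed. *)
Lemma noise_cond_prob k A : (0 < k)%N -> measurable A ->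
  cond_prob_version P (history path_rv noise_rv k) (noise_rv k @^-1` A)
    (fun o => noise_law (kap k (path o k)) A).
Proof.
move=> k0 mA.
pose y (o : coins N) := let j := kap k (path o k) in
  \sum_b bitp p j b * \1_A (xi j b).
have YE : (fun o => noise_law (kap k (path o k)) A) = EFin \o y.
  by apply/funext => o; rewrite noise_lawE.
rewrite YE; split.
- move=> B _; apply: saturated_history; first exact: finite_finset.
  move=> o o' eqn; rewrite /preimage /= /y.
  by rewrite (eq_path_noise (o' := o') (o := o)).
- exact: coin_prob_integrable.
move=> F hF; rewrite coin_prob_integral_set coin_probE; congr EFin.
have y_cst o j : xi j true = xi j false -> j = kap k (path o k) ->
    y o = \1_A (noise o k).
  move=> xij jE; rewrite /y -jE big_bool /= /noise -jE.
  by case: (o _); rewrite xij; ring.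
have [kN|Nk] := leqP k N; last first.
  apply: eq_Ex => o; have [[]|xij] := fresh_coin o k0.
    by rewrite leqNgt Nk.
  by rewrite (y_cst o _ xij erefl) mulrC indicI.
pose i : 'I_N.+1 := inord k.
have iE : i = k :> nat by rewrite inordK.
have past (o : coins N) b j : (j < k)%N ->
    set_coin o i b (inord j) = o (inord j).
  move=> jk; rewrite ffunE; case: eqP => // /(congr1 val) /=.
  rewrite inordK ?iE; first by move=> jE; rewrite jE ltnn in jk.
  by rewrite ltnS (leq_trans (ltnW jk)).
have pathE o b : path (set_coin o i b) k = path o k.
  by apply: eq_path_coins => j; exact: past.
have yE o b : y (set_coin o i b) = y o by rewrite /y pathE.
have FE o b : \1_F (set_coin o i b) = \1_F o :> R.
  have h j : (1 <= j < k)%N -> noise (set_coin o i b) j = noise o j.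
    move=> /andP[_ jk]; rewrite /noise past//; congr (xi (kap _ _) _);
      by apply: eq_path_coins => l lj; apply: past; exact: ltn_trans jk.
  rewrite !indicE; congr (nat_of_bool _)%:R; apply/idP/idP => /set_mem oF;
    apply/mem_set; move: oF; apply: history_saturated hF _ _ => // j jk.
  exact/esym/h.
have noiseE o b : noise (set_coin o i b) k = xi (kap k (path o k)) b.
  by rewrite /noise pathE ffunE eqxx.
rewrite (Ex_resample p i) [RHS](Ex_resample p i); apply: eq_Ex => o.
under eq_bigr do rewrite FE.
rewrite [RHS](eq_bigr (fun b => \1_F o *
    (bitp p i b * \1_A (xi (kap k (path o k)) b)))); last first.
  move=> b _; rewrite mulrCA; congr (_ * _).
  by rewrite indicI /= FE mulrC -noiseE.
rewrite [LHS](eq_bigr (fun b => \1_F o * (bitp p i b * y o))); last first.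
  by move=> b _; rewrite mulrCA yE.
rewrite -!mulr_sumr -mulr_suml sum_bitp mul1r; congr (_ * _).
have [[_ kE]|xij] := fresh_coin o k0; rewrite /y ?kE ?iE//.
by rewrite !big_bool /= xij; ring.
Qed.

(** In [fresh_coin] the second alternative lets a state ignore its coin, so one
    lemma serves a noise that depends on time and one that is switched off. *)
Lemma coin_oracle (sigma : R) : 0 < sigma ->
  (forall k, (0 < k)%N ->
     prob_kernel_on (domX R) (fun x => noise_law (kap k x)))
  -> (forall j, \sum_b bitp p j b * xi j b = 0) ->
  (forall j, \sum_b bitp p j b * xi j b ^+ 2 <= sigma ^+ 2) ->
  centered_kernel_oracle (domX R) sigma path_rv noise_rv
    (fun k x => noise_law (kap k x)).
Proof.
move=> s0 kernel mean var; split=> // k k1; split.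
- exact: kernel.
- by move=> x _; rewrite (noise_law_integral _ (f := id))// mean.
- move=> x _; rewrite (noise_law_integral _ (f := fun w => w ^+ 2))//.
  by rewrite lee_fin.
- move=> A mA; exists (fun o => noise_law (kap k (path o k)) A).
    exact: noise_cond_prob.
  exact: aeW.
Qed.

End process.

(** * The schedule of rare jumps *)

Section schedule.
Context (R : realType) (n m : nat).
Hypotheses (m16 : (16 <= m)%N) (mn : (m ^ 2 < n)%N).

(** With [j = n - k] steps to go, a tail of coin [k] moves the iterate down by
    [eta * drift k] and a head moves it up by [eta * jump k]. In the window
    [m <= j <= m ^ 2] a drift of order [1 / j] pays, at a bounded variance
    [jump k * drift k], for jumps of size [2 * j]. Before the window the drift
    only has to be positive and of negligible total. *)
Definition drift k : R :=
  if (k + m ^ 2 < n)%N then (16 * n%:R)^-1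
  else if (k + m <= n)%N then (8 * (n - k)%:R)^-1 else 0.

(** The initial value [m / 16] keeps the jumps away from zero before the
    window, so that heads are rare there. *)
Definition depth k : R := m%:R / 16 + \sum_(i < k) drift i.

Definition jump k : R :=
  if (k + m ^ 2 < n)%N then depth k
  else if (k + m <= n)%N then 2 * (n - k)%:R + depth k else 0.

(** The probability of a head that centers the noise; it is 0 where the noise
    is off, by the convention on division by zero. *)
Definition jump_prob k : R := drift k / (drift k + jump k).

Definition jump_noise k (b : bool) : R := if b then - jump k else drift k.

Let m_le_sq : (m <= m ^ 2)%N. Proof. by rewrite -mulnn leq_pmull; lia. Qed.

Let m16R : 16 <= m%:R :> R. Proof. by rewrite ler_nat. Qed.

Let nR_gt0 : 0 < n%:R :> R. Proof. by rewrite ltr0n; lia. Qed.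

Lemma drift_window k : (n <= k + m ^ 2)%N -> (k + m <= n)%N ->
  drift k = (8 * (n - k)%:R)^-1.
Proof. by move=> kn km; rewrite /drift ltnNge kn km. Qed.

Lemma drift_off k : (n < k + m)%N -> drift k = 0.
Proof. by move=> kn; rewrite /drift !ifN//; lia. Qed.

Lemma jump_window k : (n <= k + m ^ 2)%N -> (k + m <= n)%N ->
  jump k = 2 * (n - k)%:R + depth k.
Proof. by move=> kn km; rewrite /jump ltnNge kn km. Qed.

Lemma jump_off k : (n < k + m)%N -> jump k = 0.
Proof. by move=> kn; rewrite /jump !ifN//; lia. Qed.

Lemma jump_noise_off k b : (n < k + m)%N -> jump_noise k b = 0.
Proof. by move=> kn; case: b; rewrite /= ?jump_off ?drift_off ?oppr0. Qed.

Lemma drift_gt0 k : (k + m <= n)%N -> 0 < drift k.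
Proof.
move=> km; rewrite /drift km; case: ifP => _; rewrite invr_gt0 mulr_gt0//.
by rewrite ltr0n; lia.
Qed.

Lemma drift_ge0 k : 0 <= drift k.
Proof.
by have [/drift_gt0/ltW|/drift_off->] := leqP (k + m)%N n.
Qed.

Lemma depthS k : depth k.+1 = depth k + drift k.
Proof. by rewrite /depth big_ord_recr addrA. Qed.

Lemma depth_le k l : (k <= l)%N -> depth k <= depth l.
Proof.
elim: l => [|l IH]; first by rewrite leqn0 => /eqP->.
rewrite leq_eqVlt => /predU1P[->//|/IH/le_trans]; apply.
by rewrite depthS lerDl drift_ge0.
Qed.

Lemma depth_lt k l : (k < l)%N -> (k + m <= n)%N -> depth k < depth l.
Proof.
move=> kl km; apply: lt_le_trans (depth_le kl).
by rewrite depthS ltrDl drift_gt0.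
Qed.

Lemma depth_ge k : m%:R / 16 <= depth k.
Proof. by rewrite lerDl sumr_ge0// => i _; exact: drift_ge0. Qed.

Lemma depth_gt0 k : 0 < depth k.
Proof. by apply: lt_le_trans (depth_ge k); have m16' := m16R; lra. Qed.

Lemma jump_gt0 k : (k + m <= n)%N -> 0 < jump k.
Proof.
move=> km; rewrite /jump km; case: ifP => _; rewrite ?depth_gt0//.
by rewrite ltr_wpDl ?depth_gt0// mulr_ge0.
Qed.

Lemma jump_ge0 k : 0 <= jump k.
Proof. by have [/jump_gt0/ltW|/jump_off->] := leqP (k + m)%N n. Qed.

Lemma jump_prob01 k : 0 <= jump_prob k <= 1.
Proof.
have d0 := drift_ge0 k; have j0 := jump_ge0 k.
have s0 : 0 <= drift k + jump k by exact: addr_ge0.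
rewrite /jump_prob divr_ge0//=; have [->|sn0] := eqVneq (drift k + jump k) 0.
  by rewrite invr0 mulr0.
by rewrite ler_pdivrMr ?mul1r ?lerDl// lt_def sn0.
Qed.

(** Counting terms is enough for all the sums over the schedule: less than [n]
    terms come before the window and at most [m ^ 2] from then on. *)
Lemma two_phase_sum (f : nat -> R) a b k :
  (forall i, (i + m ^ 2 < n)%N -> f i <= a) ->
  (forall i, (n <= i + m ^ 2)%N -> (i < n)%N -> f i <= b) ->
  0 <= a -> 0 <= b -> (k <= n)%N ->
  \sum_(i < k) f i <= n%:R * a + (m ^ 2)%:R * b.
Proof.
move=> fa fb a0 b0 kn.
suff : \sum_(i < k) f i <= k%:R * a + (k + m ^ 2 - n)%:R * b.
  move/le_trans; apply; apply: lerD; rewrite ler_wpM2r// ler_nat//; lia.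
elim: k kn => [|k IH] kn.
  by rewrite big_ord0 mul0r add0r mulr_ge0.
rewrite big_ord_recr /=; have [kl|kl] := ltnP (k + m ^ 2)%N n.
  rewrite (_ : (k.+1 + _ - n = k + m ^ 2 - n)%N); last by lia.
  have := IH (ltnW kn); have := fa _ kl; rewrite -[k.+1]addn1 natrD; lra.
rewrite (_ : (k.+1 + _ - n = (k + m ^ 2 - n) + 1)%N); last by lia.
have := IH (ltnW kn); have := fb _ kl kn.
rewrite -[k.+1]addn1 !natrD; lra.
Qed.

(** Near the end of the run the accumulated drift is still smaller than what
    a jump within the window earns. *)
Lemma depth_le_quarter k : depth k <= m%:R / 4.
Proof.
wlog kn : k / (k <= n)%N => [H|].
  have [/H//|nk] := leqP k n.
  suff -> : depth k = depth n by exact: H.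
  elim: k nk => // k IH; rewrite ltnS leq_eqVlt => /predU1P[<-|nk].
    by rewrite depthS drift_off ?addr0//; lia.
  by rewrite depthS IH// drift_off ?addr0//; lia.
have m16' := m16R; have n0 := nR_gt0.
have H : \sum_(i < k) drift i <=
    n%:R * (16 * n%:R)^-1 + (m ^ 2)%:R * (8 * m%:R)^-1.
  apply: two_phase_sum => //; [| |by rewrite invr_ge0; lra..].
  - by move=> i iw; rewrite /drift iw.
  - move=> i iw _; have [im|/drift_off->] := leqP (i + m)%N n; last first.
      by rewrite invr_ge0; lra.
    rewrite drift_window// lef_pV2 ?posrE ?mulr_gt0//; last 2 first.
    + by rewrite ltr0n; lia.
    + by lra.
    by rewrite ler_pM2l// ler_nat; lia.
have -> : m%:R / 4 = m%:R / 16 + (m%:R / 16 + m%:R / 8) :> R by lra.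
rewrite /depth lerD2l (le_trans H)// lerD//.
  by rewrite invfM mulrCA divff ?gt_eqF// mulr1; lra.
have m0 : m%:R != 0 :> R by rewrite gt_eqF//; lra.
by rewrite natrX expr2 le_eqVlt; apply/orP; left; apply/eqP; field.
Qed.

Lemma jump_variance k : jump k * drift k <= 1 / 2.
Proof.
have m16' := m16R; have n0 := nR_gt0.
have dk := depth_le_quarter k; have d0 := depth_gt0 k.
have mnR : m%:R <= n%:R :> R by rewrite ler_nat; lia.
rewrite /jump /drift; case: ifP => [_|kn].
  rewrite ler_pdivrMr; lra.
case: ifP => [km|_]; last by rewrite mul0r; lra.
have jm : m%:R <= (n - k)%:R :> R by rewrite ler_nat; lia.
rewrite ler_pdivrMr; lra.
Qed.

Lemma jump_noise_mean k : \sum_b bitp jump_prob k b * jump_noise k b = 0.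
Proof.
rewrite big_bool /= /jump_prob.
have [km|km] := leqP (k + m)%N n; last by rewrite jump_off ?drift_off//; lra.
have := drift_gt0 km; have := jump_gt0 km; move=> j0 d0.
by field; rewrite gt_eqF// addr_gt0.
Qed.

Lemma jump_noise_second_moment k :
  \sum_b bitp jump_prob k b * jump_noise k b ^+ 2 = jump k * drift k.
Proof.
rewrite big_bool /= /jump_prob.
have [km|km] := leqP (k + m)%N n; last by rewrite jump_off ?drift_off//; lra.
have := drift_gt0 km; have := jump_gt0 km; move=> j0 d0.
by field; rewrite gt_eqF// addr_gt0.
Qed.

Lemma jump_noise_le k b : jump_noise k b <= drift k.
Proof.
case: b => //=; rewrite (le_trans _ (drift_ge0 k))// oppr_le0.
exact: jump_ge0.
Qed.

Lemma sum_jump_prob_le k : (k <= n)%N -> \sum_(i < k) jump_prob i <= 1 / 8.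
Proof.
move=> kn; have m16' := m16R; have n0' := nR_gt0.
have H : \sum_(i < k) jump_prob i <=
    n%:R * (n%:R * m%:R)^-1 + (m ^ 2)%:R * (16 * (m ^ 2)%:R)^-1.
  have m2 : 0 < (m ^ 2)%:R :> R by rewrite ltr0n; lia.
  apply: two_phase_sum => //; rewrite ?invr_ge0 ?mulr_ge0//.
  - move=> i iw; have im : (i + m <= n)%N by lia.
    rewrite /jump_prob ler_pdivrMr ?addr_gt0 ?drift_gt0 ?jump_gt0//.
    rewrite mulrDr -[leLHS]add0r lerD//.
      by rewrite mulr_ge0 ?drift_ge0// invr_ge0 mulr_ge0.
    rewrite /jump /drift iw ler_pdivlMl ?mulr_gt0//; last by lra.
    apply: le_trans (depth_ge i).
    rewrite invfM mulrA ler_pdivrMr//; lra.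
  - move=> i iw _; have [im|im] := leqP (i + m)%N n; last first.
      by rewrite /jump_prob drift_off// mul0r invr_ge0 mulr_ge0.
    rewrite /jump_prob ler_pdivrMr ?addr_gt0 ?drift_gt0 ?jump_gt0//.
    have j0 : 0 < (n - i)%:R :> R by rewrite ltr0n; lia.
    have d0 := depth_gt0 i.
    rewrite jump_window// drift_window//.
    rewrite mulrDr -[leLHS]add0r lerD//.
    rewrite ler_pdivlMl ?mulr_gt0// ler_pdivrMr ?mulr_gt0//.
    have mj : (m ^ 2)%:R <= (n - i)%:R * (n - i)%:R :> R.
      by rewrite -natrM ler_nat -mulnn leq_mul; lia.
    have dj : 0 <= depth i * (n - i)%:R by rewrite mulr_ge0// ltW.
    lra.
have m2 : (m ^ 2)%:R != 0 :> R by rewrite pnatr_eq0; lia.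
have m0 : m%:R != 0 :> R by rewrite pnatr_eq0; lia.
have n0 := gt_eqF nR_gt0.
apply: (le_trans H).
rewrite !invfM !mulrA divff ?n0// mul1r mulrAC divff// mul1r.
have : m%:R^-1 <= 16^-1 :> R by rewrite lef_pV2 ?posrE//; lra.
lra.
Qed.

(** Within the window the rate of a jump of size [2 * j] is of order
    [1 / j ^ 2], so that each scale contributes [1 / j] to the mean. *)
Lemma jump_prob_window k : (n <= k + m ^ 2)%N -> (k + m <= n)%N ->
  (19 * (n - k)%:R ^+ 2)^-1 <= jump_prob k.
Proof.
move=> kn km; have m16' := m16R.
have jm : m%:R <= (n - k)%:R :> R by rewrite ler_nat; lia.
have j0 : 0 < (n - k)%:R :> R by lra.
have dk := depth_le_quarter k; have d0 := depth_gt0 k.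
rewrite /jump_prob drift_window// jump_window//.
set j := (n - k)%:R in jm j0 *.
have i0 : 0 < (8 * j)^-1 by rewrite invr_gt0 mulr_gt0.
rewrite ler_pdivlMr; last by lra.
rewrite ler_pdivrMl; last by rewrite mulr_gt0 ?exprn_gt0.
have -> : 19 * j ^+ 2 * (8 * j)^-1 = 19 / 8 * j by field; rewrite gt_eqF.
have : (8 * j)^-1 <= 1 / 8 by rewrite ler_pdivlMr// mulrC ler_pdivrMr; lra.
lra.
Qed.

End schedule.

(** Each term [1 / j] bounds the increment [ln (j + 1) - ln j], and these
    telescope to [ln (m ^ 2 + 1) - ln m >= ln m]. *)
Lemma harmonic_window (R : realType) m : (0 < m)%N ->
  ln m%:R <= \sum_(m <= j < (m ^ 2).+1) (j%:R^-1 : R).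
Proof.
move=> m0; have m0R : 0 < m%:R :> R by rewrite ltr0n.
have H l : (m <= l)%N ->
    ln l%:R - ln m%:R <= \sum_(m <= j < l) (j%:R^-1 : R).
  elim: l => [|l IH]; first by lia.
  rewrite leq_eqVlt => /predU1P[<-|ml]; first by rewrite subrr big_geq.
  have l0 : 0 < l%:R :> R by rewrite ltr0n; lia.
  rewrite big_nat_recr//=.
  have -> : ln l.+1%:R = ln l%:R + ln (1 + l%:R^-1) :> R.
    rewrite -lnM ?posrE ?addr_gt0 ?invr_gt0//; congr ln.
    by rewrite mulrDr mulr1 divff ?gt_eqF// natr1.
  have := IH ml; have : ln (1 + l%:R^-1) <= l%:R^-1 :> R.
    by apply: le_ln1Dx; apply: (lt_trans (ltrN10 _)); rewrite invr_gt0.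
  lra.
apply: le_trans (H _ _); last by rewrite -mulnn; nia.
have : ln (m ^ 2)%:R <= ln (m ^ 2).+1%:R :> R.
  by rewrite ler_ln ?posrE ?ltr0n ?ler_nat ?expn_gt0 ?m0.
by rewrite natrX lnXn//; lra.
Qed.


(** * The first jump decides the last iterate *)

Lemma exclusive_sum_le (R : realType) (r : seq nat) (c : nat -> R)
    (b : nat -> bool) (x : R) : uniq r -> 0 <= x ->
  (forall j, j \in r -> b j -> c j <= x) ->
  (forall j j', j \in r -> j' \in r -> b j -> b j' -> j = j') ->
  \sum_(j <- r) c j * (b j)%:R <= x.
Proof.
move=> ur x0 cx inj; have [/hasP[j jr bj]|/hasPn nb] := boolP (has b r).
  rewrite (bigD1_seq j)//= bj mulr1 big_seq_cond big1 ?addr0 ?cx//.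
  move=> i /andP[ir ij]; case: (boolP (b i)) => bi; last by rewrite mulr0.
  by rewrite (inj i j) ?eqxx in ij.
by rewrite big_seq big1// => i /nb /negbTE->; rewrite mulr0.
Qed.

Lemma eta_depth_le (R : realType) n m (eta : R) k :
  (16 <= m)%N -> (m ^ 2 < n)%N -> 0 < eta -> 2 * eta * (m ^ 2)%:R <= 1 ->
  eta * depth R n m k <= 1 / 8.
Proof.
move=> m16 mn eta0 eta_m.
have : eta * depth R n m k <= eta * (m%:R / 4).
  by rewrite ler_pM2l ?depth_le_quarter.
have : eta * m%:R <= eta * (m ^ 2)%:R.
  by rewrite ler_pM2l// ler_nat; move: m16; rewrite -mulnn; nia.
lra.
Qed.

Section last_iterate.
Context (R : realType) (n m : nat) (eta x1 : R) (kap : nat -> R -> nat).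
Hypotheses (m16 : (16 <= m)%N) (mn : (m ^ 2 < n)%N).
Hypotheses (eta0 : 0 < eta) (eta_m : 2 * eta * (m ^ 2)%:R <= 1).
Hypotheses (x1_le0 : x1 <= 0) (x1_ge : 0 <= x1 + eta * depth R n m 1).

Local Notation depth := (depth R n m).
Local Notation path :=
  (@path R n (jump_noise R n m) kap eta x1).
Local Notation noise :=
  (@noise R n (jump_noise R n m) kap eta x1).

Hypothesis kap_path : forall k (o : coins n), (0 < k)%N ->
  kap k (path o k) = k \/ (n < kap k (path o k) + m)%N.
Hypothesis kap_start : forall k, (0 < k)%N -> (k + m <= n)%N ->
  kap k (x1 + eta * (depth 1 - depth k)) = k.

Let m16R : 16 <= m%:R :> R. Proof. by rewrite ler_nat. Qed.

(** As long as no head shows, the iterate is not positive, the subgradient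
    vanishes and the drift accumulates without projection. *)
Lemma path_before_head (o : coins n) k : (0 < k)%N -> (k + m <= n)%N ->
  (forall i, (i < k)%N -> ~~ o (inord i)) ->
  path o k = x1 + eta * (depth 1 - depth k).
Proof.
elim: k => [//|[|k] IH] _ km tails; first by rewrite path1 subrr mulr0 addr0.
rewrite pathS// /noise IH//; last 2 first.
- by lia.
- by move=> i ik; apply: tails; rewrite ltnW.
rewrite kap_start//; last by lia.
rewrite (negbTE (tails _ (leqnn _))) /=.
have x_le0 : x1 + eta * (depth 1 - depth k.+1) <= 0.
  rewrite -[leRHS]addr0 lerD// pmulr_rle0// subr_le0.
  exact: (depth_le R m16 mn).
rewrite /gplus x_le0 add0r (depthS _ _ _ k.+1) clamp_id; first by ring.
have := eta_depth_le k.+2 m16 mn eta0 eta_m; rewrite (depthS _ _ _ k.+1).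
have := drift_ge0 R m16 mn k.+1; have := eta_depth_le 1 m16 mn eta0 eta_m.
have := x1_ge; have := x1_le0.
have : 0 <= eta * drift R n m k.+1 by rewrite mulr_ge0 ?drift_ge0// ltW.
lra.
Qed.

(** A head in the window lands at [2 * eta * j] or above, whatever the depth it
    starts from, as the jump compensates for the depth. *)
Lemma path_at_head (o : coins n) k :
  (0 < k)%N -> (n <= k + m ^ 2)%N -> (k + m <= n)%N ->
  first_head (inord k) o -> 2 * eta * (n - k)%:R <= path o k.+1.
Proof.
move=> k0 kn km /andP[ok /forallP tails].
have kE : (inord k : 'I_n.+1) = k :> nat by rewrite inordK//; lia.
rewrite pathS// /noise path_before_head//; last first.
  move=> i ik; have := tails (inord i); rewrite kE inordK ?ik//; lia.
rewrite kap_start// ok /= jump_window//.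
have x_le0 : x1 + eta * (depth 1 - depth k) <= 0.
  rewrite -[leRHS]addr0 lerD// pmulr_rle0// subr_le0.
  exact: (depth_le R m16 mn).
rewrite /gplus x_le0 add0r; apply: le_clamp.
  by have := x1_ge; lra.
apply: le_trans eta_m; rewrite ler_pM2l ?mulr_gt0// ler_nat.
lia.
Qed.

(** Each step lowers the iterate by the subgradient and at most the drift,
    whatever the coins show: further heads only raise it. *)
Lemma path_decay (o : coins n) k i y : (0 < k)%N -> y <= 1 -> y <= path o k ->
  y - eta * i%:R - eta * (depth (k + i) - depth k) <= path o (k + i).
Proof.
move=> k0 y1 yk; have e0 := eta0.
have le1 l : y - eta * l%:R - eta * (depth (k + l) - depth k) <= 1.
  have : 0 <= eta * l%:R by rewrite mulr_ge0// ltW.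
  have : 0 <= eta * (depth (k + l) - depth k).
    by rewrite mulr_ge0 ?subr_ge0 ?depth_le ?leq_addr// ltW.
  lra.
elim: i => [|i IH]; first by rewrite addn0 subrr !mulr0 !subr0.
have ki0 : (0 < k + i)%N by lia.
move: (le1 i.+1); rewrite addnS => le1S; rewrite pathS//.
apply: le_clamp => //.
have g1 : gplus R (path o (k + i)) <= 1 by rewrite /gplus; case: ifP.
have w1 : noise o (k + i) <= drift R n m (k + i).
  rewrite /noise; have [->|/(jump_noise_off R m16 mn)->] := kap_path o ki0.
    exact: (jump_noise_le R m16 mn).
  exact: (drift_ge0 R m16 mn).
have : eta * (gplus R (path o (k + i)) + noise o (k + i)) <=
    eta * (1 + drift R n m (k + i)) by rewrite ler_pM2l// lerD.
rewrite depthS -natr1; lra.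
Qed.

Lemma path_last_ge (o : coins n) k :
  (0 < k)%N -> (n <= k + m ^ 2)%N -> (k + m <= n)%N ->
  first_head (inord k) o -> 3 / 4 * eta * (n - k)%:R <= path o n.
Proof.
move=> k0 kn km ok; have e0 := eta0; have h := m16R.
have jm : m%:R <= (n - k)%:R :> R by rewrite ler_nat; lia.
have top : 2 * eta * (n - k)%:R <= 1.
  by apply: le_trans eta_m; rewrite ler_pM2l ?mulr_gt0// ler_nat; lia.
have := path_decay (n - k.+1) (ltn0Sn _) top (path_at_head k0 kn km ok).
rewrite subnKC; last by lia.
have -> : (n - k.+1)%:R = (n - k)%:R - 1 :> R.
  by rewrite (_ : (n - k = (n - k.+1) + 1)%N) ?natrD ?addrK//; lia.
apply: le_trans.
have : eta * (depth n - depth k.+1) <= eta * ((n - k)%:R / 4).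
  rewrite ler_pM2l//.
  have := depth_le_quarter R m16 mn n; have := depth_gt0 R m16 mn k.+1; lra.
lra.
Qed.

(** The constant is [3 / 4 * (7 / 8) * (1 / 19)]: the value kept at time [n],
    the chance of no earlier head, and the chance of the head itself. The events
    that the first head comes at different times are exclusive, so that the
    contributions of the scales [j] add up. *)
Lemma Ex_path_last_ge :
  21 / 608 * (eta * ln m%:R) <=
  Ex (jump_prob R n m) (fun o : coins n => fplus R (path o n)).
Proof.
have e0 := eta0; have h := m16R.
pose r := index_iota m (m ^ 2).+1.
have rP j : j \in r -> [/\ (0 < n - j)%N, (n <= n - j + m ^ 2)%N,
    (n - j + m <= n)%N & (n - (n - j) = j)%N].
  by rewrite mem_index_iota => /andP[mj jm]; split; lia.
apply: (@le_trans _ _ (Ex (jump_prob R n m) (fun o : coins n =>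
   \sum_(j <- r) 3 / 4 * eta * j%:R * (first_head (inord (n - j)) o)%:R))).
  rewrite Ex_sum.
  apply: (@le_trans _ _ (\sum_(j <- r) 21 / 608 * eta * j%:R^-1)).
    rewrite -mulr_sumr mulrA ler_pM2l; last by lra.
    by apply: harmonic_window; lia.
  rewrite big_seq [leRHS]big_seq; apply: ler_sum => j jr.
  have [n0 nj jn jE] := rP j jr.
  have j0 : 0 < j%:R :> R.
    by move: jr; rewrite mem_index_iota ltr0n; lia.
  rewrite ExZ.
  have kE : (inord (n - j) : 'I_n.+1) = (n - j)%N :> nat.
    by rewrite inordK//; lia.
  have := Ex_first_head_ge (jump_prob01 R m16 mn) (inord (n - j) : 'I_n.+1).
  rewrite kE; have := jump_prob_window R m16 mn nj jn; rewrite jE => pj.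
  have := sum_jump_prob_le R m16 mn (leq_subr j n) => sj qj.
  have pj0 : 0 < (19 * j%:R ^+ 2)^-1 :> R.
    by rewrite invr_gt0 mulr_gt0// exprn_gt0.
  have q : (19 * j%:R ^+ 2)^-1 * (7 / 8) <=
      Ex (jump_prob R n m)
        (fun o : coins n => (first_head (inord (n - j)) o)%:R).
    apply: le_trans qj; apply: ler_pM => //; lra.
  apply: (@le_trans _ _
    (3 / 4 * eta * j%:R * ((19 * j%:R ^+ 2)^-1 * (7 / 8)))).
    rewrite le_eqVlt; apply/orP; left; apply/eqP; field.
    by rewrite gt_eqF.
  by rewrite ler_pM2l// !mulr_gt0.
apply: Ex_le => [k|o]; first exact: (jump_prob01 R m16 mn).
apply: exclusive_sum_le.
- exact: iota_uniq.
- by rewrite /fplus le_max lexx orbT.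
- move=> j /rP[n0 nj jn jE] oj; rewrite /fplus le_max.
  by have := path_last_ge n0 nj jn oj; rewrite jE => ->.
move=> j j' /rP[_ _ jn jE] /rP[_ _ jn' jE'] /andP[oj /forallP tj].
move=> /andP[oj' /forallP tj'].
have := tj (inord (n - j')); have := tj' (inord (n - j)).
rewrite oj oj' !implybF !inordK; [|lia|lia].
lia.
Qed.

End last_iterate.

(** * The objective *)

Section objective.
Variable R : realType.

Lemma domXP (x : R) : domX R x <-> - 2 <= x <= 1.
Proof. by rewrite /domX /= in_itv. Qed.

Lemma fplus_ge0 (x : R) : 0 <= fplus R x.
Proof. by rewrite /fplus le_max lexx orbT. Qed.

Lemma argmin_fplus : argmin (domX R) (fplus R) = `[-2, 0]%classic.
Proof.
apply/seteqP; split=> x /=; rewrite in_itv /=.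
  move=> [/domXP/andP[x2 x1] /(_ 0)]; rewrite x2 /fplus maxxx ge_max => h.
  by have /andP[] : (x <= 0) && (0 <= 0 :> R) by apply: h; apply/domXP; lra.
move=> /andP[x2 x0]; split; first by apply/domXP; lra.
by move=> y _; rewrite {1}/fplus max_r// fplus_ge0.
Qed.

Lemma minval_fplus : minval (domX R) (fplus R) = 0.
Proof.
have : argmin (domX R) (fplus R) (xget 0 (argmin (domX R) (fplus R))).
  apply: xgetPex; exists 0; rewrite argmin_fplus /= in_itv /=; lra.
rewrite {1}argmin_fplus /= in_itv /= => /andP[_ x0].
by rewrite /minval /fplus max_r.
Qed.

Lemma fplus_convex : convex_function (domX R : set R^o) (fplus R : R^o -> R^o).
Proof.
move=> t x y _ _; rewrite !convRE /fplus.
have t0 : 0 <= t%:inum by [].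
have s0 : 0 <= 1 - t%:inum by rewrite subr_ge0.
rewrite ge_max; apply/andP; split.
  by apply: lerD; rewrite ler_wpM2l// le_max lexx.
by rewrite addr_ge0// mulr_ge0// le_max lexx orbT.
Qed.

Lemma fplus_lipschitz : 1.-lipschitz_(domX R) (fplus R).
Proof.
move=> [x y] _ /=; rewrite mul1r /fplus.
rewrite ler_norml; apply/andP; split; move: (ler_norm (x - y));
  move: (ler_norm (y - x)); rewrite (distrC y x);
  case: (leP x 0) => ?; case: (leP y 0) => ?; lra.
Qed.

Lemma gplus_subgradient (x : R) : domX R x -> -1 <= gplus R x <= 1 /\
  relative_subgradient (domX R) (fplus R) x (gplus R x).
Proof.
move=> _; rewrite /gplus; case: (leP x 0) => x0.
  split=> [|y _]; first by lra.
  by rewrite mul0r addr0 {1}/fplus max_r// fplus_ge0.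
split=> [|y _]; first by lra.
rewrite {1}/fplus (max_l (ltW x0)) mul1r addrC subrK.
by rewrite /fplus le_max lexx.
Qed.

End objective.

(** * The two oracles *)

(** Up to finitely many points a preimage is everything or nothing. *)
Lemma cofinite_cst_measurable (R : realType) d (T : measurableType d)
    (h : R -> T) (F : set R) (c : T) (D : set R) :
  finite_set F -> (forall x, ~ F x -> h x = c) -> measurable D ->
  measurable_fun D h.
Proof.
move=> finF hc mD _ B _; apply: measurableI => //.
have fin_meas (A : set R) : finite_set A -> measurable A.
  move=> finA; apply: countable_measurable; first exact: measurable_set1.
  exact: (finite_set_countable finA).
have -> : h @^-1` B = (h @^-1` B `&` F) `|` (if c \in B then ~` F else set0).
  apply/seteqP; split=> x /=.
    have [Fx|nFx] := pselect (F x); first by left.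
    by rewrite hc// => Bc; right; rewrite mem_set.
  by case=> [[]//|]; case: ifPn => // /set_mem Bc /hc ->.
apply: measurableU; first exact: fin_meas (finite_setIr _ finF).
case: ifP => _; first exact: measurableC (fin_meas _ finF).
exact: measurable0.
Qed.

Section two_oracles.
Context (R : realType) (n m : nat) (eta : R).
Hypotheses (m16 : (16 <= m)%N) (mn : (m ^ 2 < n)%N).
Hypotheses (eta0 : 0 < eta) (eta_m : 2 * eta * (m ^ 2)%:R <= 1).

Local Notation depth := (depth R n m).
Local Notation law := (noise_law (jump_prob01 R m16 mn) (jump_noise R n m)).

Lemma jump_oracle (sigma : R) kap x1 :
  0 < sigma -> 1 / 2 <= sigma ^+ 2 ->
  (forall k, (0 < k)%N -> prob_kernel_on (domX R) (fun x => law (kap k x))) ->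
  (forall k (o : coins n), (0 < k)%N ->
     let j := kap k (path (jump_noise R n m) kap eta x1 o k) in
     j = k \/ (n < j + m)%N) ->
  centered_kernel_oracle (domX R) sigma
    (path_rv n (jump_prob01 R m16 mn) (jump_noise R n m) kap eta x1)
    (noise_rv n (jump_prob01 R m16 mn) (jump_noise R n m) kap eta x1)
    (fun k x => law (kap k x)).
Proof.
move=> s0 s2 kernel kapP; apply: coin_oracle => //.
- move=> k o k0; have off j : (n < j + m)%N ->
      jump_noise R n m j true = jump_noise R n m j false.
    by move=> jm; rewrite !(jump_noise_off R m16 mn).
  have /= [kE|/off] := kapP k o k0; last by right.
  have [kn|nk] := leqP k n; first by left.
  by right; apply: off; rewrite kE; lia.
- exact: jump_noise_mean.
- move=> j; rewrite jump_noise_second_moment//.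
  exact: le_trans (jump_variance R m16 mn j) s2.
Qed.

Lemma expectation_last_ge kap x1 : x1 <= 0 -> 0 <= x1 + eta * depth 1 ->
  (forall k (o : coins n), (0 < k)%N ->
     let j := kap k (path (jump_noise R n m) kap eta x1 o k) in
     j = k \/ (n < j + m)%N) ->
  (forall k, (0 < k)%N -> (k + m <= n)%N ->
     kap k (x1 + eta * (depth 1 - depth k)) = k) ->
  ((21 / 608 * (eta * ln m%:R))%:E <=
   'E_(coin_prob (jump_prob01 R m16 mn) n)[fun o =>
      (fplus R (path_rv n (jump_prob01 R m16 mn) (jump_noise R n m) kap eta x1 n o)
       - minval (domX R) (fplus R))%R])%E.
Proof.
move=> x0 x1d kapP kapS; rewrite unlock coin_prob_integral lee_fin.
apply: le_trans (Ex_path_last_ge m16 mn eta0 eta_m x0 x1d kapP kapS) _.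
by apply: Ex_le => [|o]; [exact: jump_prob01|rewrite minval_fplus subr0].
Qed.

Lemma noise_law_on j : (j + m <= n)%N -> law j [set 0] = 0%E.
Proof.
move=> jm; have d0 := drift_gt0 R m16 mn jm; have j0 := jump_gt0 R m16 mn jm.
rewrite noise_lawE big_bool /= !indicE !memNset ?mulr0 ?addr0//= => /eqP.
  by rewrite gt_eqF.
by rewrite oppr_eq0 gt_eqF.
Qed.

Lemma noise_law_off j : (n < j + m)%N -> law j [set 0] = 1%E.
Proof.
move=> jm; rewrite noise_lawE.
rewrite -[RHS](congr1 EFin (sum_bitp (jump_prob R n m) j)); congr EFin; apply: eq_bigr => b _.
by rewrite (jump_noise_off R m16 mn)// indicE mem_set// mulr1.
Qed.

(** Until its first jump the iterate started at [- eta * depth 1] passes at time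
    [k] through [- eta * depth k]. The depth increases, so the state determines
    the time, and a time-homogeneous kernel can follow the schedule. All other
    states are sent to an index at which the noise is off. *)
Definition clock (x : R) : nat :=
  find (fun i => x == - (eta * depth i)) (iota 0 (n - m).+1).

Let m_le_n : (m <= n)%N.
Proof. by apply: leq_trans (ltnW mn); rewrite -mulnn leq_pmull; lia. Qed.

Lemma clockE k : (k + m <= n)%N -> clock (- (eta * depth k)) = k.
Proof.
move=> km; pose a i := - (eta * depth k) == - (eta * depth i).
have ha : has a (iota 0 (n - m).+1).
  by apply/hasP; exists k; rewrite /a ?eqxx// mem_iota; lia.
have := nth_find 0%N ha; move: ha; rewrite has_find size_iota => fn.
rewrite nth_iota// add0n /a eqr_opp => /eqP/(mulfI (lt0r_neq0 eta0)) dE.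
rewrite /clock -/a; have [fk|kf|//] := ltngtP (find a (iota 0 (n - m).+1)) k.
  have fm : (find a (iota 0 (n - m).+1) + m <= n)%N by lia.
  by have := depth_lt R m16 mn fk fm; rewrite -dE ltxx.
have := depth_lt R m16 mn kf km.
by rewrite -dE ltxx.
Qed.

Lemma clock_off (x : R) :
  (forall i, (i + m <= n)%N -> x != - (eta * depth i)) -> (n < clock x + m)%N.
Proof.
move=> xn; rewrite /clock hasNfind ?size_iota; first by lia.
by apply/hasPn => i; rewrite mem_iota => im; apply: xn; have := m_le_n; lia.
Qed.

Lemma clock_ge0 (x : R) : 0 <= x -> (n < clock x + m)%N.
Proof.
move=> x0; apply: clock_off => i _; rewrite gt_eqF// (lt_le_trans _ x0)//.
by rewrite oppr_lt0 mulr_gt0 ?(depth_gt0 R m16 mn).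
Qed.

Lemma clock_measurable : prob_kernel_on (domX R) (fun x => law (clock x)).
Proof.
move=> A _.
pose F := [set - (eta * depth i) | i in [set i | (i + m <= n)%N]].
apply: (@cofinite_cst_measurable _ _ _ _ F (law (n - m).+1 A)).
- apply: finite_image; apply: (sub_finite_set _ (finite_II n.+1)) => i /=.
  lia.
- move=> x Fx; congr (law _ A); rewrite /clock hasNfind ?size_iota//.
  apply/hasPn => i; rewrite mem_iota => im; apply/negP => /eqP xE; apply: Fx.
  by exists i => //=; have := m_le_n; lia.
- exact: measurable_itv.
Qed.

Let cpath := @path R n (jump_noise R n m) (fun=> clock) eta (- (eta * depth 1)).

Lemma clock_noise_off (o : coins n) k : (n < clock (cpath o k) + m)%N ->
  noise (jump_noise R n m) (fun=> clock) eta (- (eta * depth 1)) o k = 0.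
Proof. by move=> off; rewrite /noise (jump_noise_off R m16 mn). Qed.

(** Jumps land on multiples of [eta] and the subgradient steps stay there, so
    an iterate that has left the clock states never meets them again. *)
Lemma clock_path (o : coins n) k : (0 < k)%N ->
  cpath o k = - (eta * depth k) \/
  exists2 i : nat, cpath o k = eta * i%:R & eta * i%:R <= 1.
Proof.
have e0 := eta0; have em := eta_m.
elim: k => // -[|k] IH _; first by left.
have dk l := eta_depth_le l m16 mn eta0 eta_m.
have d0 l : 0 < eta * depth l by rewrite mulr_gt0// (depth_gt0 R m16 mn).
have [kE|[i iE i1]] := IH (ltn0Sn k); last first.
  (* off the clock: the noise is off and only the subgradient acts *)
  right; have i0 : 0 <= eta * i%:R by rewrite mulr_ge0// ltW.
  have off : noise (jump_noise R n m) (fun=> clock) eta (- (eta * depth 1))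
      o k.+1 = 0.
    by apply: clock_noise_off; apply: clock_ge0; rewrite iE.
  exists i.-1; last first.
    by apply: le_trans i1; rewrite ler_pM2l// ler_nat leq_pred.
  rewrite /cpath pathS// off addr0 -/cpath iE.
  case: i iE i1 i0 => [|i] iE i1 i0.
    rewrite mulr0 /gplus lexx mulr0 subr0 clamp_id//; lra.
  have i0' : 0 < eta * i.+1%:R by rewrite mulr_gt0.
  have i0'' : 0 <= eta * i%:R by rewrite mulr_ge0// ltW.
  rewrite /gplus leNgt i0' /= clamp_id -natr1; [ring|].
  by move: i1; rewrite -natr1; lra.
have g0 : gplus R (cpath o k.+1) = 0.
  by rewrite kE /gplus oppr_le0 ltW ?d0.
have [km|km] := leqP (k.+1 + m)%N n; last first.
  (* the schedule is over and the clock has stopped *)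
  left; rewrite /cpath pathS// clock_noise_off; last first.
    rewrite -/cpath kE; apply: clock_off => i im.
    rewrite eqr_opp (inj_eq (mulfI (lt0r_neq0 eta0))) gt_eqF//.
    by apply: (depth_lt R m16 mn) => //; lia.
  rewrite -/cpath g0 kE addr0 mulr0 subr0 (depthS _ _ _ k.+1) drift_off// addr0.
  by rewrite clamp_id//; have := dk k.+1; have := d0 k.+1; lra.
(* in the schedule: a head jumps off the clock, a tail advances it *)
rewrite /cpath pathS// -/cpath g0 add0r /noise.
rewrite -/cpath kE clockE//; case: (o _) => /=.
  right; have [kw|kw] := ltnP (k.+1 + m ^ 2)%N n.
    exists 0%N; last by rewrite mulr0.
    rewrite /jump kw mulr0 clamp_id; lra.
  have j1 : eta * (2 * (n - k.+1))%:R <= 1.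
    apply: le_trans em; rewrite natrM mulrCA mulrA ler_pM2l ?mulr_gt0//.
    by rewrite ler_nat; lia.
  exists (2 * (n - k.+1))%N => //.
  have j0 : 0 <= eta * (2 * (n - k.+1))%:R by rewrite mulr_ge0// ltW.
  rewrite jump_window// -[RHS]clamp_id; last by lra.
  by congr clamp; rewrite natrM; ring.
left; rewrite (depthS _ _ _ k.+1) clamp_id; first by ring.
have := dk k.+2; have := d0 k.+1; rewrite (depthS _ _ _ k.+1).
have : 0 < eta * drift R n m k.+1.
  by rewrite mulr_gt0// (drift_gt0 R m16 mn).
lra.
Qed.

Lemma clock_fresh (o : coins n) k : (0 < k)%N ->
  clock (cpath o k) = k \/ (n < clock (cpath o k) + m)%N.
Proof.
move=> k0; have [->|[i -> _]] := clock_path o k0; last first.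
  by right; apply: clock_ge0; rewrite mulr_ge0// ltW.
have [km|km] := leqP (k + m)%N n; first by left; exact: clockE.
right; apply: clock_off => i im.
rewrite eqr_opp (inj_eq (mulfI (lt0r_neq0 eta0))) gt_eqF//.
by apply: (depth_lt R m16 mn) => //; lia.
Qed.

Lemma homogeneous_oracle :
  exists (d : measure_display) (T : measurableType d) (P : probability T R)
      (X W : nat -> {RV P >-> R}) (Q : nat -> R -> probability R R),
    [/\ centered_kernel_oracle (domX R) (Num.sqrt 3) X W Q,
        time_homogeneous (domX R) Q,
        ~ state_independent (domX R) Q,
        exists2 x1 : R, argmin (domX R) (fplus R) x1 &
                        forall w, X 1%N w = x1 &
        projected_iterates (domX R) (gplus R) eta X W /\
        ((21 / 608 * (eta * ln m%:R))%:E
           <= 'E_P[fun w => (fplus R (X n w) - minval (domX R) (fplus R))%R])%E].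
Proof.
have e0 := eta0.
have d1 := eta_depth_le 1 m16 mn eta0 eta_m.
have d0 : 0 < eta * depth 1 by rewrite mulr_gt0// (depth_gt0 R m16 mn).
have m1 : (1 + m <= n)%N by move: mn; rewrite -mulnn; nia.
pose x1 := - (eta * depth 1).
exists _, (coins n), (coin_prob (jump_prob01 R m16 mn) n).
exists (path_rv n _ (jump_noise R n m) (fun=> clock) eta x1).
exists (noise_rv n _ (jump_noise R n m) (fun=> clock) eta x1).
exists (fun _ x => law (clock x)); split.
- apply: jump_oracle.
  + by rewrite sqrtr_gt0.
  + by rewrite sqr_sqrtr//; lra.
  + by move=> k _; exact: clock_measurable.
  + by move=> k o; exact: clock_fresh.
- by exists (fun x => law (clock x)) => //; exact: clock_measurable.
- move=> /(_ 1%N isT)[mu muE].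
  have dom0 : domX R 0 by apply/domXP; lra.
  have dom1 : domX R x1 by apply/domXP; rewrite /x1; lra.
  have := muE _ _ dom0 (measurable_set1 0).
  rewrite -(muE _ _ dom1 (measurable_set1 0)) noise_law_off ?clock_ge0//.
  rewrite /x1 clockE// noise_law_on//.
  by move=> /eqP; rewrite onee_eq0.
- exists x1 => //; rewrite argmin_fplus /= in_itv /= /x1; lra.
split; first exact: path_rv_projected_iterates.
apply: expectation_last_ge.
- by rewrite oppr_le0 ltW.
- by rewrite addNr.
- by move=> k o; exact: clock_fresh.
- move=> k _ km; rewrite /x1 (_ : - _ + _ = - (eta * depth k)); last by ring.
  exact: clockE.
Qed.

Lemma state_independent_oracle :
  exists (d : measure_display) (T : measurableType d) (P : probability T R)
      (X W : nat -> {RV P >-> R}) (Q : nat -> R -> probability R R),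
    [/\ centered_kernel_oracle (domX R) (Num.sqrt (1 / 2)) X W Q,
        state_independent (domX R) Q,
        ~ time_homogeneous (domX R) Q,
        forall w, X 1%N w = 0 &
        projected_iterates (domX R) (gplus R) eta X W /\
        ((21 / 608 * (eta * ln m%:R))%:E
           <= 'E_P[fun w => (fplus R (X n w) - minval (domX R) (fplus R))%R])%E].
Proof.
have m1 : (1 + m <= n)%N by move: mn; rewrite -mulnn; nia.
exists _, (coins n), (coin_prob (jump_prob01 R m16 mn) n).
exists (path_rv n _ (jump_noise R n m) (fun k _ => k) eta 0).
exists (noise_rv n _ (jump_noise R n m) (fun k _ => k) eta 0).
exists (fun k _ => law k); split.
- apply: jump_oracle.
  + by rewrite sqrtr_gt0; lra.
  + by rewrite sqr_sqrtr//; lra.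
  + by move=> k _ A _; exact: measurable_cst.
  + by move=> k o _ /=; left.
- by move=> k _; exists (law k).
- move=> [Q0 _ QE]; have dom0 : domX R 0 by apply/domXP; lra.
  have := QE n.+1 _ _ (ltn0Sn n) dom0 (measurable_set1 0).
  rewrite -(QE 1%N _ _ isT dom0 (measurable_set1 0)) noise_law_off; last by lia.
  by rewrite noise_law_on// => /eqP; rewrite onee_eq0.
- by [].
split; first exact: path_rv_projected_iterates.
apply: expectation_last_ge => //.
- by rewrite add0r mulr_ge0 ?ltW// (depth_gt0 R m16 mn).
- by move=> k o _ /=; left.
Qed.

End two_oracles.

(** * Choice of the window *)

Section window.
Context (R : realType) (cl cu c : R) (n : nat).
Hypotheses (cl0 : 0 < cl) (clc : cl <= c) (ccu : c <= cu).

(** The lower bound on [Num.sqrt n%:R] collects what is used of it: the step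
    size is below [1 / 512], the window fits in the run, and [c ^+ 2] is below
    [Num.sqrt n%:R]. *)
Hypothesis n_large : 512 * cu + cl^-1 + cu ^+ 2 + 1 <= Num.sqrt n%:R.

Local Notation s := (@Num.sqrt R n%:R).
Local Notation eta := (c / s).

Lemma sqrt_large : [/\ 0 < c, 1 <= s, 512 * c <= s, c^-1 < s & c ^+ 2 <= s].
Proof.
have nl := n_large.
have c0 : 0 < c by exact: lt_le_trans clc.
have cu0 : 0 < cu by exact: lt_le_trans ccu.
have i0 : 0 < cl^-1 by rewrite invr_gt0.
have ci : c^-1 <= cl^-1 by rewrite lef_pV2.
have c2 : c ^+ 2 <= cu ^+ 2 by rewrite !expr2 ler_pM// (ltW c0).
have c20 : 0 <= c ^+ 2 by rewrite exprn_ge0// ltW.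
have ccu' := ccu.
by split=> //; lra.
Qed.

Lemma eta_gt0 : 0 < eta.
Proof. by have [c0 s1 _ _ _] := sqrt_large; rewrite divr_gt0//; lra. Qed.

Lemma window_exists : exists m : nat,
  [/\ (16 <= m)%N, (m ^ 2 < n)%N, 2 * eta * (m ^ 2)%:R <= 1 &
      eta^-1 <= (m ^ 4)%:R].
Proof.
have e0 := eta_gt0; have [c0 s1 sc ci _] := sqrt_large.
have s0 : 0 < s by lra.
have s2 : s ^+ 2 = n%:R by rewrite sqr_sqrtr.
have eV : eta^-1 = s / c by rewrite invf_div.
have eV512 : 512 <= eta^-1 by rewrite eV ler_pdivlMr.
pose t := Num.sqrt (eta^-1 / 2).
have t0 : 0 <= t by exact: sqrtr_ge0.
have t2 : t ^+ 2 = eta^-1 / 2 by rewrite sqr_sqrtr//; lra.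
have t16 : 16 <= t.
  by rewrite -(@ler_pXn2r _ 2)// ?nnegrE// t2; lra.
pose m := Num.truncn t.
have [mt tm] : m%:R <= t /\ t < m.+1%:R by apply/andP; exact: truncn_itv.
have m16 : (16 <= m)%N by rewrite -ltnS -(ltr_nat R); apply: le_lt_trans tm.
have m2 : (m ^ 2)%:R <= eta^-1 / 2.
  by rewrite natrX -t2 lerXn2r ?nnegrE.
exists m; split=> //.
- rewrite -(ltr_nat R) -s2; apply: le_lt_trans m2 _; rewrite eV expr2.
  have : s * c^-1 < s * s by rewrite ltr_pM2l.
  have : 0 < s * c^-1 by rewrite mulr_gt0 ?invr_gt0.
  lra.
- have e2 : eta * (eta^-1 / 2) = 1 / 2 by rewrite mulrA divff ?gt_eqF.
  have : eta * (m ^ 2)%:R <= eta * (eta^-1 / 2) by rewrite ler_pM2l.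
  rewrite e2; lra.
have m2' : 4 / 10 * eta^-1 <= (m ^ 2)%:R.
  have : (15 / 16 * t) ^+ 2 <= (m%:R : R) ^+ 2.
    rewrite lerXn2r ?nnegrE//; first by rewrite mulr_ge0//; lra.
    by move: tm; rewrite -natr1; lra.
  rewrite exprMn t2 -natrX; lra.
rewrite (_ : (m ^ 4 = m ^ 2 * m ^ 2)%N); last by rewrite -expnD.
rewrite natrM; apply: (@le_trans _ _ (4 / 10 * eta^-1 * (4 / 10 * eta^-1))).
  have : 512 * eta^-1 <= eta^-1 * eta^-1 by rewrite ler_pM2r// invr_gt0.
  lra.
by apply: ler_pM => //; lra.
Qed.

Lemma ln_eta_window m : (0 < m)%N -> eta^-1 <= (m ^ 4)%:R ->
  ln (1 / eta) <= 4 * ln m%:R.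
Proof.
move=> m0 em; have e0 := eta_gt0; have m0R : 0 < m%:R :> R by rewrite ltr0n.
have -> : 4 * ln m%:R = ln (m ^ 4)%:R :> R by rewrite natrX lnXn// mulr_natl.
by rewrite div1r ler_ln ?posrE ?invr_gt0// ltr0n expn_gt0 m0.
Qed.

Lemma ln_n : ln (n%:R : R) = 2 * ln s.
Proof.
have [_ s1 _ _ _] := sqrt_large; have s0 : 0 < s by lra.
by rewrite mulr_natl -lnXn// sqr_sqrtr.
Qed.

Lemma ln_n_ge0 : 0 <= ln (n%:R : R).
Proof.
by have [_ s1 _ _ _] := sqrt_large; rewrite ln_n mulr_ge0// ln_ge0.
Qed.

Lemma ln_eta_ge : ln n%:R / 4 <= ln (1 / eta).
Proof.
have [c0 s1 _ _ c2] := sqrt_large; have s0 : 0 < s by lra.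
have : ln (c ^+ 2) <= ln s by rewrite ler_ln ?posrE ?exprn_gt0.
by rewrite ln_n div1r invf_div ln_div ?posrE// lnXn//; lra.
Qed.

Lemma rate_ge :
  cl / 2 ^+ 11 * (ln n%:R / Num.sqrt n%:R) <= 1 / 512 * (eta * ln (1 / eta)).
Proof.
have [c0 s1 _ _ _] := sqrt_large; have s0 : 0 < s by lra.
apply: (@le_trans _ _ (1 / 512 * (eta * (ln n%:R / 4)))).
  have : cl * (s^-1 * ln n%:R) <= c * (s^-1 * ln n%:R).
    by rewrite ler_wpM2r// mulr_ge0 ?ln_n_ge0// invr_ge0 ltW.
  lra.
have := ler_wpM2l (ltW eta_gt0) ln_eta_ge; lra.
Qed.

End window.

Theorem theorem3 (R : realType) :
  [/\ convex_function (domX R : set R^o) (fplus R : R^o -> R^o),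
      1.-lipschitz_(domX R) (fplus R),
      minval (domX R) (fplus R) = 0,
      argmin (domX R) (fplus R) = `[-2, 0]%classic &
      forall x, domX R x -> -1 <= gplus R x <= 1 /\
        relative_subgradient (domX R) (fplus R) x (gplus R x)] /\
  forall cl cu : R, 0 < cl -> cl <= cu ->
  exists n0 : nat, forall n : nat, (n0 <= n)%N ->
  forall c : R, cl <= c <= cu ->
  let eta := c / Num.sqrt n%:R in
  (exists (d : measure_display) (T : measurableType d) (P : probability T R)
      (X W : nat -> {RV P >-> R}) (Q : nat -> R -> probability R R),
    [/\ centered_kernel_oracle (domX R) (Num.sqrt 3) X W Q,
        time_homogeneous (domX R) Q,
        ~ state_independent (domX R) Q,
        exists2 x1 : R, argmin (domX R) (fplus R) x1 &
                        forall w, X 1%N w = x1 &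
        projected_iterates (domX R) (gplus R) eta X W /\
        ((1 / 512 * (eta * ln (1 / eta)))%:E
           <= 'E_P[fun w => (fplus R (X n w) - minval (domX R) (fplus R))%R])%E /\
        cl / 2 ^+ 11 * (ln n%:R / Num.sqrt n%:R)
           <= 1 / 512 * (eta * ln (1 / eta))]) /\
  (exists (d : measure_display) (T : measurableType d) (P : probability T R)
      (X W : nat -> {RV P >-> R}) (Q : nat -> R -> probability R R),
    [/\ centered_kernel_oracle (domX R) (Num.sqrt (1 / 2)) X W Q,
        state_independent (domX R) Q,
        ~ time_homogeneous (domX R) Q,
        forall w, X 1%N w = 0 &
        projected_iterates (domX R) (gplus R) eta X W /\
        ((1 / 128 * (eta * ln (1 / eta)))%:E
           <= 'E_P[fun w => (fplus R (X n w) - minval (domX R) (fplus R))%R])%E /\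
        cl / 2 ^+ 11 * (ln n%:R / Num.sqrt n%:R)
           <= 1 / 128 * (eta * ln (1 / eta))]).
Proof.
split.
  split; [exact: fplus_convex|exact: fplus_lipschitz|exact: minval_fplus|
    exact: argmin_fplus|exact: gplus_subgradient].
move=> cl cu cl0 clu.
pose L := 512 * cu + cl^-1 + cu ^+ 2 + 1.
have L0 : 0 <= L.
  have cu0 : 0 < cu by exact: lt_le_trans clu.
  have : 0 < cl^-1 by rewrite invr_gt0.
  by have := sqr_ge0 cu; rewrite /L; lra.
exists (Num.truncn (L ^+ 2)).+1 => n nL c /andP[clc ccu] eta.
have n_large : L <= Num.sqrt n%:R.
  rewrite -(ger0_norm L0) -sqrtr_sqr ler_wsqrtr//.
  by apply: ltW; apply: lt_le_trans (truncnS_gt _) _; rewrite ler_nat.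
have e0 := eta_gt0 cl0 clc ccu n_large.
have [m [m16 mn em me]] := window_exists cl0 clc ccu n_large.
have rate := rate_ge cl0 clc ccu n_large.
have lnE := ln_eta_window cl0 clc ccu n_large (ltn_trans (ltn0Sn _) m16) me.
have lnE0 : 0 <= eta * ln (1 / eta).
  rewrite mulr_ge0// ?(ltW e0)//.
  apply: le_trans (ln_eta_ge cl0 clc ccu n_large).
  by rewrite divr_ge0// (ln_n_ge0 cl0 clc ccu n_large).
have low : 1 / 512 * (eta * ln (1 / eta)) <= 1 / 128 * (eta * ln (1 / eta)).
  by lra.
have high : 1 / 128 * (eta * ln (1 / eta)) <= 21 / 608 * (eta * ln m%:R).
  have : eta * ln (1 / eta) <= eta * (4 * ln m%:R) by rewrite ler_pM2l.
  lra.
split.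
  have := le_trans low high => {}high.
  have [d [T [P [X [W [Q [oracle hom nsi x1 [iter E]]]]]]]] :=
    homogeneous_oracle m16 mn e0 em.
  exists d, T, P, X, W, Q; split=> //; split=> //; split=> //.
  by apply: le_trans E; rewrite lee_fin.
have [d [T [P [X [W [Q [oracle si nhom x1 [iter E]]]]]]]] :=
  state_independent_oracle m16 mn e0 em.
exists d, T, P, X, W, Q; split=> //; split=> //; split.
  by apply: le_trans E; rewrite lee_fin.
exact: le_trans rate low.
Qed.
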